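(* Let $(X,x)$ be feasible for $SDP_{NL}$. If $G$ is a directed acyclic graph, then $X_{ef}=0$ whenever $e,f\in A$ are arcs such that there exists no $s$-$t$ path in $G$ containing both arcs $e$ and $f$.
   Context: $G=(V,A)$ is a directed graph with $|V|=n$ vertices and $|A|=m$ arcs, with a source vertex $s\in V$ and a target vertex $t\in V$, $s\neq t$. An $s$-$t$ path is a sequence of distinct vertices $(v_1,\dots,v_k)$, $k>1$, with $v_1=s$, $v_k=t$ and $(v_i,v_{i+1})\in A$ for $i=1,\dots,k-1$. The incidence matrix $\mathcal{I}$ of $G$ is the $n\times m$ matrix with $\mathcal{I}_{v,e}=1$ if arc $e$ leaves vertex $v$, $-1$ if $e$ enters $v$, and $0$ otherwise; its $i$th row is denoted $a_i^{\mathrm T}$. The vector $b\in\mathbb{R}^n$ is given by $b_s=1$, $b_t=-1$, and $b_i=0$ otherwise. $Q\in\mathbb{R}^{m\times m}$ is a given nonnegative symmetric matrix; rows and columns of $m\times m$ matrices are indexed by arcs. The SDP relaxation $SDP_{NL}$ is: minimize $\langle Q,X\rangle$ over symmetric $X\in\mathbb{R}^{m\times m}$ and $x\in\mathbb{R}^m$ subject to $$a_s^{\mathrm T}x=b_s,\quad \operatorname{diag}(X)=x,\quad \begin{pmatrix} X & x \\ x^{\mathrm T} & 1 \end{pmatrix}\succeq0,\quad \langle a_ia_i^{\mathrm T},X\rangle=b_i^2\ \ \forall i\in V\setminus\{t\},\quad X\ge0,$$ where $X\ge 0$ means entrywise nonnegativity, $\langle M,N\rangle=\operatorname{trace}(M^{\mathrm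 T}N)$, $\operatorname{diag}(X)$ is the vector of diagonal entries of $X$, and $\succeq0$ means symmetric positive semidefinite. *)

(* Defs.v *)
From mathcomp Require Import all_boot all_order all_algebra.
From mathcomp Require Import reals.

Set Implicit Arguments.
Unset Strict Implicit.
Unset Printing Implicit Defensive.

Import Order.TTheory GRing.Theory Num.Theory.
Local Open Scope ring_scope.

(* A directed graph is a finite type V of vertices with a set A of ordered
   pairs; (u, v) \in A is an arc leaving u and entering v.  Coordinates
   e : 'I_#|A| and i : 'I_#|V| stand for the arc [enum_val e] and the vertex
   [enum_val i]. *)

Section Digraph.
Variables (V : finType) (A : {set V * V}).

Definition arc_rel : rel V := fun u v => (u, v) \in A.

(* Loops and pairs of antiparallel arcs count as directed cycles. *)
Definition acyclic : Prop :=
  forall c : seq V, c != [::] -> ~ ucycle arc_rel c.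

(* p = [:: v_1; ...; v_k] is the whole vertex sequence, both ends included;
   as p is nonempty, the default s of head and last is never used. *)
Definition is_st_path (s t : V) (p : seq V) : Prop :=
  [/\ uniq p,
      (1 < size p)%N,
      head s p = s,
      last s p = t
    & sorted arc_rel p].

Definition path_arcs (p : seq V) : seq (V * V) := zip p (behead p).

End Digraph.

Section Matrices.
Variable R : realType.

Definition mxdot (m n : nat) (M N : 'M[R]_(m, n)) : R := \tr (M^T *m N).

Definition psdmx (n : nat) (M : 'M[R]_n) : Prop :=
  M^T = M /\ forall v : 'cV[R]_n, 0 <= (v^T *m M *m v) ord0 ord0.

Definition diag_vec (n : nat) (M : 'M[R]_n) : 'cV[R]_n := \col_i M i i.

End Matrices.

Section SDP.
Variables (R : realType) (V : finType) (A : {set V * V}) (s t : V).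

Definition incidence : 'M[R]_(#|V|, #|A|) :=
  \matrix_(i, e)
    if enum_val i == (enum_val e).1 then 1
    else if enum_val i == (enum_val e).2 then -1
    else 0.

Definition inc_row (v : V) : 'cV[R]_#|A| := (row (enum_rank v) incidence)^T.

Definition rhs (v : V) : R :=
  if v == s then 1 else if v == t then -1 else 0.

(* Feasible pairs of SDP_NL; the cost matrix Q occurs only in its objective
   <Q, X>, hence not here. *)
Record SDP_NL_feasible (X : 'M[R]_#|A|) (x : 'cV[R]_#|A|) : Prop := {
  feas_sym : X^T = X;
  feas_source : ((inc_row s)^T *m x) ord0 ord0 = rhs s;
  feas_diag : diag_vec X = x;
  feas_psd : psdmx (block_mx X x x^T 1%:M);
  feas_flow : forall i : V, i != t ->
    mxdot (inc_row i *m (inc_row i)^T) X = rhs i ^+ 2;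
  feas_ge0 : forall e f, 0 <= X e f
}.

End SDP.

(* Main.v *)
Require Import Defs.
From mathcomp Require Import all_boot all_order all_algebra.
From mathcomp Require Import reals.
From mathcomp Require Import lra.

Set Implicit Arguments.
Unset Strict Implicit.
Unset Printing Implicit Defensive.

Import Order.TTheory GRing.Theory Num.Theory.
Local Open Scope ring_scope.

(** Positive semidefiniteness turns the quadratic constraints into linear ones:
    [X a_i = 0] for [i != s, t] and [X a_s = x].  Hence each row [X e _] is a
    nonnegative [s]-[t] flow whose value [x e = X e e] equals its flow along
    [e].  If [S] is closed under predecessors, then the flow leaving [S] is at
    most that value, so [S] cannot have both [e] and another arc [f] with
    [X e f > 0] among its outgoing arcs.  For [S] the set of ancestors of the
    tails of [e] and [f], acyclicity then forces one of the two arcs to be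
    reachable from the other; the sets of ancestors of a tail and of
    non-descendants of a head likewise show that [s] reaches both arcs and both
    reach [t]. *)

(** * Walks in acyclic digraphs *)

Section AcyclicDigraph.
Variables (V : finType) (A : {set V * V}).
Hypothesis acyclicA : acyclic A.

Lemma acyclic_no_return (u v : V) : (u, v) \in A -> ~~ connect (arc_rel A) v u.
Proof.
move=> uvA; apply/negP => /connectP[p vp u_last].
case/shortenP: vp u_last => p' vp' Up' _ u_last.
apply: (acyclicA (c := v :: p')) => //; rewrite /ucycle Up' andbT /=.
by rewrite rcons_path vp' -u_last.
Qed.

Lemma acyclic_path_uniq (x : V) (p : seq V) :
  path (arc_rel A) x p -> uniq (x :: p).
Proof.
elim: p x => [|y p IHp] x //= /andP[xyA yp].
have /= -> := IHp _ yp; rewrite andbT.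
by apply: contra (acyclic_no_return xyA) => /(path_connect yp).
Qed.

Lemma acyclic_loopless (a : V * V) : a \in A -> a.1 != a.2.
Proof.
by case: a => u v uvA; apply: contraNneq (acyclic_no_return uvA) => /= ->.
Qed.

Lemma mem_path_arcs_cat (u v : V) (p q : seq V) :
  (u, v) \in path_arcs (rcons p u ++ v :: q).
Proof.
elim: p => [|x [|y p] IHp] /=; first by rewrite inE eqxx.
  by rewrite !inE eqxx orbT.
by rewrite inE; apply/orP; right; exact: IHp.
Qed.

(** The connecting walks are simply concatenated with the two arcs. In an acyclic digraph every walk
    has distinct vertices, so no shortening, which might lose an arc, has to be done. *)
Lemma acyclic_st_path (s t a b c d : V) :
    (a, b) \in A -> (c, d) \in A ->
    connect (arc_rel A) s a -> connect (arc_rel A) d t ->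
    (a, b) = (c, d) \/ connect (arc_rel A) b c ->
  exists p, [/\ is_st_path A s t p, (a, b) \in path_arcs p
              & (c, d) \in path_arcs p].
Proof.
move=> abA cdA /connectP[p sp a_last] /connectP[q dq t_last] bc.
have st_path r : path (arc_rel A) s r -> last s r = t -> r != [::] ->
    is_st_path A s t (s :: r).
  by move=> sr rt r0; split; rewrite ?acyclic_path_uniq //; case: (r) r0.
(* Exposes [a] as the last vertex of the prefix, the shape in which [mem_path_arcs_cat] recognises
   an arc. *)
have cons_p w : s :: p ++ w = rcons (belast s p) a ++ w.
  by rewrite a_last -lastI.
case: bc => [[eac ebd]|/connectP[r br c_last]].
  exists (s :: p ++ d :: q); rewrite eac ebd in a_last cons_p *.
  have in_arcs : (c, d) \in path_arcs (s :: p ++ d :: q).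
    by rewrite cons_p mem_path_arcs_cat.
  split=> //; apply: st_path; last by case: (p).
    by rewrite cat_path sp /= -a_last dq andbT.
  by rewrite last_cat.
exists (s :: p ++ b :: r ++ d :: q); split.
- apply: st_path; last by case: (p).
    rewrite cat_path sp /= -a_last; apply/andP; split=> //.
    by rewrite cat_path br /= -c_last; apply/andP.
  by rewrite last_cat /= last_cat.
- by rewrite cons_p mem_path_arcs_cat.
- have -> : s :: p ++ b :: r ++ d :: q
            = rcons (s :: p ++ belast b r) c ++ d :: q.
    by rewrite rcons_cons rcons_cat c_last -lastI cat_cons -catA.
  exact: mem_path_arcs_cat.
Qed.

End AcyclicDigraph.

(** * Flows across predecessor-closed sets *)

Section Flow.
Variables (R : realType) (V : finType) (A : {set V * V}) (s t : V).
Hypotheses (s_neq_t : s != t) (acyclicA : acyclic A).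

Implicit Types (e f : 'I_#|A|) (y : 'I_#|A| -> R) (S : {set V}).

Local Notation tail e := (enum_val e).1.
Local Notation head e := (enum_val e).2.
Local Notation reach := (connect (arc_rel A)).

Definition divergence y (v : V) : R := \sum_f y f * inc_row R A v f ord0.

Definition st_flow y (c : R) : Prop :=
  (forall f, 0 <= y f) /\
  (forall v, v != t -> divergence y v = c * (v == s)%:R).

Definition pred_closed S : Prop :=
  forall u v, (u, v) \in A -> v \in S -> u \in S.

Definition leaves S e : bool := (tail e \in S) && (head e \notin S).

Lemma arc_in e : (tail e, head e) \in A.
Proof. by rewrite -surjective_pairing enum_valP. Qed.

(** Acyclicity enters by excluding loops: on a loop the nested conditional of [incidence] would give
    1, the difference 0. *)
Lemma inc_rowE (v : V) f :
  inc_row R A v f ord0 = (tail f == v)%:R - (head f == v)%:R.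
Proof.
rewrite !mxE enum_rankK ![v == _]eq_sym.
have /= := acyclic_loopless acyclicA (arc_in f).
case: (eqVneq (tail f) v) => [->|_].
  by rewrite eq_sym => /negPf ->; rewrite subr0.
by case: (head f == v); rewrite ?subr0 ?sub0r.
Qed.

Lemma sum_divergence y S :
  \sum_(v in S) divergence y v
    = \sum_f y f * ((tail f \in S)%:R - (head f \in S)%:R).
Proof.
have sum_eq (w : V) : \sum_(v in S) (w == v)%:R = (w \in S)%:R :> R.
  rewrite big_mkcond (bigD1 w) //= eqxx big1 ?addr0; first by case: (w \in S).
  by move=> v /negPf v_w; rewrite eq_sym v_w if_same.
rewrite exchange_big; apply: eq_bigr => f _ /=.
rewrite -mulr_sumr; congr (_ * _).
by rewrite (eq_bigr _ (fun v _ => inc_rowE v f)) sumrB !sum_eq.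
Qed.

Lemma sum_st_divergence y c S : st_flow y c ->
  \sum_(v in S) divergence y v = c * ((s \in S)%:R - (t \in S)%:R).
Proof.
case=> _ flow_y.
have sum_s (P : pred V) : (forall v, P v -> v != t) ->
    \sum_(v | P v) divergence y v = c * (P s)%:R.
  move=> P_t; rewrite (eq_bigr (fun v => c * (v == s)%:R)); last first.
    by move=> v /P_t /flow_y.
  rewrite -mulr_sumr big_mkcond (bigD1 s) //= eqxx big1 ?addr0; last first.
    by move=> v /negPf v_s; rewrite v_s if_same.
  by case: (P s).
(* [st_flow] is silent at [t]; the value there is forced because the divergences over all vertices
   cancel. *)
have div_t : divergence y t = - c.
  have : \sum_(v in [set: V]) divergence y v = 0.
    by rewrite sum_divergence big1 // => f _; rewrite !inE subrr mulr0.
  rewrite (bigD1 t) ?inE //= sum_s ?inE ?s_neq_t; last by move=> v /andP[].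
  by rewrite mulr1 => /eqP; rewrite addr_eq0 => /eqP.
case tS: (t \in S); last first.
  by rewrite sum_s ?subr0 // => v; apply: contraTneq => ->; rewrite tS.
rewrite (bigD1 t) //= div_t sum_s ?s_neq_t ?andbT; last by move=> v /andP[].
by rewrite mulrBr mulr1 addrC.
Qed.

(** No arc enters a predecessor-closed set from outside, so its net outflow is its gross outflow. *)
Lemma leaving_flow y c S : st_flow y c -> pred_closed S ->
  \sum_(f | leaves S f) y f = c * ((s \in S)%:R - (t \in S)%:R).
Proof.
move=> flow_y closedS; rewrite -(sum_st_divergence S flow_y) sum_divergence.
rewrite big_mkcond; apply: eq_bigr => f _; rewrite /leaves.
case head_S: (head f \in S); last first.
  by rewrite andbT subr0; case: ifP; rewrite ?mulr1 ?mulr0.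
by rewrite (closedS _ _ (arc_in f) head_S) subrr mulr0.
Qed.

Lemma leaving_flow_ends y c S f :
    st_flow y c -> 0 <= c -> pred_closed S -> leaves S f -> 0 < y f ->
  [/\ s \in S, t \notin S & 0 < c].
Proof.
move=> flow_y c_ge0 closedS leave_f yf_gt0.
have : 0 < \sum_(f | leaves S f) y f.
  by rewrite (bigD1 f) //= ltr_wpDr // sumr_ge0 // => ? _; apply: flow_y.1.
rewrite (leaving_flow flow_y closedS).
(* The positive outflow equals [c], [0] or [- c]; as [0 <= c], only the first is possible. *)
by case: (s \in S); case: (t \in S) => /=; split; lra.
Qed.

Lemma pred_closed_ancestors (P : pred V) :
  pred_closed [set w | [exists v, P v && reach w v]].
Proof.
move=> u v uvA; rewrite !inE => /existsP[w /andP[Pw vw]].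
by apply/existsP; exists w; rewrite Pw (connect_trans (connect1 uvA) vw).
Qed.

Lemma st_flow_reach y c f : st_flow y c -> 0 <= c -> 0 < y f ->
  [/\ reach s (tail f), reach (head f) t & 0 < c].
Proof.
move=> flow_y c_ge0 yf_gt0.
pose S1 := [set w | [exists v, pred1 (tail f) v && reach w v]].
have leave1 : leaves S1 f.
  rewrite /leaves !inE; apply/andP; split.
    by apply/existsP; exists (tail f); rewrite /= eqxx connect0.
  apply/existsP => -[_ /andP[/eqP->]]; apply/negP.
  exact: acyclic_no_return (arc_in f).
pose S2 := [set w | ~~ reach (head f) w].
have closed2 : pred_closed S2.
  move=> u v uvA; rewrite !inE; apply: contra => fu.
  exact: connect_trans fu (connect1 uvA).
have leave2 : leaves S2 f.
  by rewrite /leaves !inE connect0 (acyclic_no_return acyclicA) // arc_in.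
have [+ _ c_gt0] := leaving_flow_ends flow_y c_ge0
  (@pred_closed_ancestors _) leave1 yf_gt0.
have [_ + _] := leaving_flow_ends flow_y c_ge0 closed2 leave2 yf_gt0.
by rewrite !inE negbK => ft /existsP[_ /andP[/eqP-> sf]].
Qed.

(** Otherwise both arcs leave the set [S] of ancestors of their tails, which then emits at least
    [y e + y f], more than the total value [y e]. *)
Lemma st_flow_comparable y e f : st_flow y (y e) -> 0 < y f ->
  [\/ e = f, reach (head e) (tail f) | reach (head f) (tail e)].
Proof.
move=> flow_y yf_gt0.
have [e_f|e_f] := eqVneq e f; first exact: Or31.
have [ef|ef] := boolP (reach (head e) (tail f)); first exact: Or32.
have [fe|fe] := boolP (reach (head f) (tail e)); first exact: Or33.
pose S := [set w | [exists v, pred2 (tail e) (tail f) v && reach w v]].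
have leave_arc g : g = e \/ g = f -> leaves S g.
  move=> g_ef; rewrite /leaves !inE; apply/andP; split.
    apply/existsP; exists (tail g); rewrite connect0 andbT /=.
    by case: g_ef => ->; rewrite eqxx ?orbT.
  (* A head cannot reach its own tail by acyclicity, nor the other tail by the assumed
     incomparability. *)
  apply/existsP => -[_ /andP[/pred2P[]->]]; apply/negP;
    by case: g_ef => -> //; apply: acyclic_no_return (arc_in _).
have := leaving_flow flow_y (@pred_closed_ancestors _ : pred_closed S).
have leave_e : leaves S e by apply: leave_arc; left.
have leave_f : leaves S f by apply: leave_arc; right.
rewrite (bigD1 e) //= (bigD1 f) /=; last by rewrite leave_f eq_sym.
have : 0 <= \sum_(g | leaves S g && (g != e) && (g != f)) y g.
  by rewrite sumr_ge0 // => g _; apply: flow_y.1.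
have := flow_y.1 e.
by case: (s \in S); case: (t \in S) => /=; lra.
Qed.

End Flow.

(** * Isotropic vectors of a semidefinite matrix *)

Section Semidefinite.
Variable R : realType.

(** Along [v + a *: w] with [w = M *m v], the form is [2 * a * n2 + a ^+ 2 * k]. It is nonnegative
    for every [a], so the squared norm [n2] of [w] vanishes. *)
Lemma psdmx_kernel (n : nat) (M : 'M[R]_n) (v : 'cV[R]_n) :
  psdmx M -> (v^T *m M *m v) ord0 ord0 = 0 -> M *m v = 0.
Proof.
case=> symM posM qv0; pose w := M *m v.
pose k : R := (w^T *m M *m w) ord0 ord0; pose n2 : R := (w^T *m w) ord0 ord0.
have vMw : (v^T *m M *m w) ord0 ord0 = n2.
  by rewrite /n2 {2}/w trmx_mul symM.
have wMv : (w^T *m M *m v) ord0 ord0 = n2 by rewrite -mulmxA.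
have entryD (B C : 'M[R]_1) : (B + C) ord0 ord0 = B ord0 ord0 + C ord0 ord0.
  by rewrite mxE.
have entryZ a (B : 'M[R]_1) : (a *: B) ord0 ord0 = a * B ord0 ord0.
  by rewrite mxE.
have q_ge0 a : 0 <= a * n2 + (a * n2 + a * (a * k)).
  have trD : (v + a *: w)^T = v^T + a *: w^T by rewrite linearD linearZ.
  have := posM (v + a *: w).
  rewrite trD !mulmxDl !mulmxDr -!scalemxAl -!scalemxAr.
  by rewrite !(entryD, entryZ) qv0 vMw wMv -/k add0r; lra.
have k_ge0 : 0 <= k by exact: posM.
have n2_0 : n2 = 0.
  have k1 : k + 1 != 0 by rewrite gt_eqF // ltr_wpDl.
  (* Dividing by [k + 1] avoids the case [k = 0]; the form at this point is [- z ^+ 2 * (k + 2)]. *)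
  have := q_ge0 (- (n2 / (k + 1))).
  set z := n2 / (k + 1); have -> : n2 = z * (k + 1) by rewrite divfK.
  move=> z_le; suff -> : z = 0 by rewrite mul0r.
  have : z ^+ 2 * (k + 2) <= 0 by lra.
  rewrite pmulr_lle0 ?ltr_wpDl // => z2_le0.
  by apply/eqP; rewrite -sqrf_eq0 eq_le z2_le0 sqr_ge0.
apply/matrixP => i j; rewrite (ord1 j) [RHS]mxE.
apply/eqP; rewrite -sqrf_eq0; apply/eqP.
have : \sum_i0 (w i0 ord0) ^+ 2 = 0.
  by rewrite -[RHS]n2_0 [n2]mxE; apply: eq_bigr => i0 _; rewrite [w^T _ _]mxE.
by move/psumr_eq0P => -> // i0 _; exact: sqr_ge0.
Qed.

End Semidefinite.

(** * Rows of a feasible matrix as flows *)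

Section Feasible.
Variables (R : realType) (V : finType) (A : {set V * V}) (s t : V).
Variables (X : 'M[R]_#|A|) (x : 'cV[R]_#|A|).
Hypothesis feasX : SDP_NL_feasible s t X x.

Local Notation M := (block_mx X x x^T 1%:M).
Local Notation inc v := (inc_row R A v).

Lemma feasible_diag e : X e e = x e ord0.
Proof. by rewrite -(feas_diag feasX) mxE. Qed.

Lemma feasible_quad v : v != t ->
  ((inc v)^T *m X *m inc v) ord0 ord0 = rhs R s t v ^+ 2.
Proof.
move=> v_t; rewrite -(feas_flow feasX v_t) /mxdot trmx_mul trmxK.
by rewrite -[in RHS]mulmxA [RHS]mxtrace_mulC trace_mx11.
Qed.

Lemma block_quad (v : 'cV[R]_#|A|) (c : 'M[R]_1) :
  (col_mx v c)^T *m M *m col_mx v c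
    = v^T *m X *m v + c^T *m x^T *m v + (v^T *m x *m c + c^T *m c).
Proof.
by rewrite tr_col_mx mul_row_block mul_row_col mulmx1 !mulmxDl.
Qed.

(** The block matrix has form zero at [inc v] extended by 0, hence kills this vector; the upper
    block is the claim. *)
Lemma feasible_inner v : v != t -> v != s -> X *m inc v = 0.
Proof.
move=> v_t v_s.
have /(psdmx_kernel (feas_psd feasX)) :
    ((col_mx (inc v) (0 : 'M_1))^T *m M *m col_mx (inc v) 0) ord0 ord0 = 0.
  rewrite block_quad trmx0 !mul0mx !mulmx0 !addr0 feasible_quad //.
  by rewrite /rhs (negPf v_s) (negPf v_t) expr0n.
rewrite mul_block_col mulmx0 addr0 -[0 in RHS]col_mx0.
by case/eq_col_mx.
Qed.

Lemma feasible_source : s != t -> X *m inc s = x.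
Proof.
move=> s_t; have rhs_s : rhs R s t s = 1 by rewrite /rhs eqxx.
have source := feas_source feasX; rewrite rhs_s in source.
(* The last coordinate [-1] completes a square: the form is 1 - 2 + 1, from the quadratic and the
   linear source constraints. *)
have /(psdmx_kernel (feas_psd feasX)) :
    ((col_mx (inc s) (- 1%:M : 'M_1))^T *m M *m col_mx (inc s) (- 1%:M))
      ord0 ord0 = 0.
  have xs : x^T *m inc s = (inc s)^T *m x.
    by rewrite -[RHS]trmxK trmx_mul trmxK [x^T *m _]mx11_scalar tr_scalar_mx.
  rewrite block_quad linearN /= trmx1 !mulNmx !mulmxN !mul1mx !mulmx1 opprK xs.
  move: source (feasible_quad s_t); rewrite rhs_s.
  move: ((inc s)^T *m x) ((inc s)^T *m X *m inc s) => B C B1 C1.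
  by rewrite !mxE eqxx B1 C1 expr1n subrr addNr addr0.
rewrite mul_block_col mulmxN mulmx1 -[0 in RHS]col_mx0.
by case/eq_col_mx => /eqP + _; rewrite subr_eq0 => /eqP.
Qed.

Lemma feasible_flow e : s != t -> st_flow s t (X e) (X e e).
Proof.
move=> s_t; split=> [f|v v_t]; first exact: feas_ge0 feasX _ _.
have -> : divergence (X e) v = (X *m inc v) e ord0 by rewrite [RHS]mxE.
have [->|v_s] := eqVneq v s.
  by rewrite feasible_source // feasible_diag mulr1.
by rewrite feasible_inner // mxE mulr0.
Qed.

End Feasible.

Theorem lemma5p2 (R : realType) (V : finType) (A : {set V * V}) (s t : V)
    (s_neq_t : s != t)
    (X : 'M[R]_#|A|) (x : 'cV[R]_#|A|)
    (feasX : SDP_NL_feasible s t X x)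
    (acyclicA : acyclic A)
    (e f : 'I_#|A|)
    (no_path : ~ exists p : seq V,
       [/\ is_st_path A s t p,
           enum_val e \in path_arcs p
         & enum_val f \in path_arcs p]) :
  X e f = 0.
Proof.
apply/eqP; rewrite eq_le (feas_ge0 feasX) andbT leNgt; apply/negP => Xef_gt0.
have flow_e := feasible_flow feasX e s_neq_t.
have Xee_ge0 := feas_ge0 feasX e e.
have [sf ft Xee_gt0] := st_flow_reach s_neq_t acyclicA flow_e Xee_ge0 Xef_gt0.
(* The flow in row [e] has positive value [X e e], which is also its amount on [e], so the same
   lemma applies to [e] itself. *)
have [se et _] := st_flow_reach s_neq_t acyclicA flow_e Xee_ge0 Xee_gt0.
apply: no_path.
have arc_e := arc_in e; have arc_f := arc_in f.
rewrite [enum_val e]surjective_pairing [enum_val f]surjective_pairing.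
have [e_f|ef|fe] := st_flow_comparable s_neq_t acyclicA flow_e Xef_gt0.
- by apply: acyclic_st_path => //; left; rewrite e_f.
- by apply: acyclic_st_path => //; right.
- have [] := acyclic_st_path acyclicA arc_f arc_e sf et (or_intror fe).
  by move=> p [st_p fp ep]; exists p.
Qed.
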